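(* Let $0<\rho<1$. Then, as $N\to\infty$ through odd positive integers, \[ \sup_{|z|<\rho}\left|S_{N,\frac{N+1}2}(z)-\frac{z}{1+z^2}\right|<\frac{1}{2(1-\rho)^2}\,\frac1N+o\left(\frac1N\right), \] i.e. there is a real sequence $(\varepsilon_N)$ with $N\varepsilon_N\to0$ such that the left-hand side is less than $\frac{1}{2(1-\rho)^2N}+\varepsilon_N$ for all sufficiently large odd $N$.
   Context: For integers $N\ge 1$ and $1\le j\le N$, the Suffridge polynomial is \[ S_{N,j}(z)= \sum_{k=1}^N \frac{N+1-k}{N}\, \frac{\sin\frac{kj\pi }{N+1}}{\sin\frac{j\pi}{N+1}}\, z^k . \] The function $K^{(2)}(z)=\frac{z}{1+z^2}$ is the 2-symmetric Koebe function. *)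

(* Defs.v *)
From Stdlib Require Import Reals.
From Coquelicot Require Import Coquelicot.
Open Scope R_scope.

(* Meaningful for 1 <= j <= N, which makes both denominators nonzero. *)
Definition suffridge (N j : nat) (z : C) : C :=
  sum_n_m
    (fun k : nat =>
       (RtoC ((INR N + 1 - INR k) / INR N
              * (sin (INR k * INR j * PI / (INR N + 1))
                 / sin (INR j * PI / (INR N + 1)))) * z ^ k)%C)
    1 N.

Definition koebe2 (z : C) : C := (z / (1 + z ^ 2))%C.

(* The supremum is taken in the extended reals, so it is p_infty for a
   function that is unbounded on the disc. *)
Definition sup_disc (rho : R) (f : C -> C) : Rbar :=
  Lub_Rbar (fun x : R => exists z : C, Cmod z < rho /\ x = Cmod (f z)).

(* Main.v *)
Require Import Defs.
From Stdlib Require Import Reals Lra Lia.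
From Coquelicot Require Import Coquelicot.
Open Scope R_scope.

(** With [w = - z^2] and [N = 2 m + 1], the middle Suffridge polynomial is
    [z / N] times the arithmetic-geometric sum of [(N - 2 i) w^i], [i <= m].
    Summing it in closed form gives the exact error
    [S - K = z / N * (- 2 w + w^(m+1) (1 + w)) / (1 - w)^2].
    On the disc its modulus is at most [2 rho^3 / (1 - rho^2)^2 / N] up to a
    term of order [rho^N / N], and [4 rho^3 < (1 + rho)^2] for [rho < 1]. *)

Lemma sin_even_half_pi (m : nat) : sin (INR (2 * m) * (PI / 2)) = 0.
Proof.
  apply sin_eq_0_1. exists (Z.of_nat m).
  rewrite <- INR_IZR_INZ, mult_INR. simpl. field.
Qed.

Lemma sin_odd_half_pi (m : nat) : sin (INR (2 * m + 1) * (PI / 2)) = (-1) ^ m.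
Proof.
  induction m as [|m IH].
  - simpl. rewrite Rmult_1_l. apply sin_PI2.
  - replace (INR (2 * S m + 1) * (PI / 2))
      with (INR (2 * m + 1) * (PI / 2) + PI).
    + rewrite neg_sin, IH. simpl. ring.
    + rewrite !plus_INR, !mult_INR, (S_INR m).
      change (INR 2) with 2. change (INR 1) with 1. field.
Qed.

(** Even [k] drop out and odd [k = 2 i + 1] contribute [q (a - 1 - 2 i) z w^i] with [w = - z^2]. The
    coefficients are affine in [i], so multiplying by [(1 - w)^2] takes second differences and only
    boundary terms survive. Keeping [a] free of [m] lets the induction lengthen the sum without
    changing its coefficients. *)
Lemma arith_sin_sum_odd (q a : R) (m : nat) (z : C) :
  ((1 + z ^ 2) ^ 2 *
     sum_n_m (fun k : nat =>
       RtoC (q * (a - INR k) * sin (INR k * (PI / 2))) * z ^ k) 1 (2 * m + 1)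
   = q * z * ((a - 1) * (1 + z ^ 2) + 2 * z ^ 2
       + (- z ^ 2) ^ S m * (2 * INR (S m) - (a - 1)
                            - (a - 1 - 2 * INR m) * z ^ 2)))%C.
Proof.
  induction m as [|m IH].
  - change (2 * 0 + 1)%nat with 1%nat. rewrite sum_n_n.
    change (INR 1) with 1. change (INR 0) with 0.
    rewrite Rmult_1_l, sin_PI2, !RtoC_mult, !RtoC_minus. ring.
  - replace (2 * S m + 1)%nat with (S (S (2 * m + 1))) by lia.
    rewrite !sum_n_Sm by lia.
    replace (S (S (2 * m + 1))) with (2 * S m + 1)%nat by lia.
    replace (S (2 * m + 1)) with (2 * S m)%nat by lia.
    rewrite sin_even_half_pi, sin_odd_half_pi.
    rewrite !Rmult_0_r, Cmult_0_l.
    change (@plus C_AbelianMonoid) with Cplus.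
    rewrite Cplus_0_r, Cmult_plus_distr_l, IH.
    rewrite !RtoC_mult, RtoC_pow, Cpow_add_r, Cpow_mult_r.
    (* Splitting off the sign makes [(-1)^m] and [(z^2)^m] the only symbolic powers on both
       sides. *)
    replace (- z ^ 2)%C with (RtoC (-1) * z ^ 2)%C by ring.
    rewrite !Cpow_S, !Cpow_mult_l.
    rewrite plus_INR, mult_INR, !(S_INR (S m)), !(S_INR m).
    change (INR 2) with 2. change (INR 1) with 1.
    rewrite !RtoC_minus, !RtoC_plus, !RtoC_mult, !RtoC_plus.
    ring.
Qed.

Lemma one_plus_sqr_neq0 (z : C) : Cmod z < 1 -> (1 + z ^ 2)%C <> 0.
Proof.
  intros Hz H0.
  assert (E : (z ^ 2 = - (1))%C).
  { replace (z ^ 2)%C with (1 + z ^ 2 - 1)%C by ring. rewrite H0. ring. }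
  apply (f_equal Cmod) in E. rewrite Cmod_pow, Cmod_m1 in E.
  pose proof (Cmod_ge_0 z). nra.
Qed.

(** Take [q = 1 / N] and [a = N + 1] in the closed form: the part [(a - 1) (1 + z^2)] yields exactly
    the Koebe function, while [2 (m + 1) - (a - 1)] and [a - 1 - 2 m] both equal 1. *)
Lemma suffridge_middle_error (m : nat) (z : C) :
  (1 + z ^ 2)%C <> 0 ->
  (suffridge (2 * m + 1) (m + 1) z - koebe2 z
   = z * (2 * z ^ 2 + (- z ^ 2) ^ S m * (1 - z ^ 2))
     / (INR (2 * m + 1) * (1 + z ^ 2) ^ 2))%C.
Proof.
  intros Hz.
  set (d := INR (2 * m + 1)).
  assert (Hd : d = 2 * INR m + 1).
  { unfold d. rewrite plus_INR, mult_INR. reflexivity. }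
  assert (Hd0 : d <> 0) by (pose proof (pos_INR m); lra).
  assert (Hj : INR (m + 1) = INR m + 1) by (rewrite plus_INR; reflexivity).
  pose proof (arith_sin_sum_odd (/ d) (d + 1) m z) as Hsum.
  assert (Hs : suffridge (2 * m + 1) (m + 1) z =
    sum_n_m (fun k : nat =>
       RtoC (/ d * (d + 1 - INR k) * sin (INR k * (PI / 2))) * z ^ k)%C
       1 (2 * m + 1)).
  { unfold suffridge. fold d. apply sum_n_m_ext. intros k.
    f_equal. f_equal.
    (* Here [j = (N + 1) / 2], so the normalising sine is 1 and the other one has argument
       [k PI / 2]. *)
    replace (INR (m + 1) * PI / (d + 1)) with (PI / 2)
      by (rewrite Hj, Hd; field; pose proof (pos_INR m); lra).
    replace (INR k * INR (m + 1) * PI / (d + 1)) with (INR k * (PI / 2))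
      by (rewrite Hj, Hd; field; pose proof (pos_INR m); lra).
    rewrite sin_PI2. field. exact Hd0. }
  rewrite <- Hs in Hsum. clear Hs.
  set (s := suffridge _ _ _) in *.
  assert (HdC : RtoC d <> 0) by (intros E; apply Hd0; apply RtoC_inj, E).
  replace s with ((1 + z ^ 2) ^ 2 * s / (1 + z ^ 2) ^ 2)%C
    by (field; exact Hz).
  rewrite Hsum. unfold koebe2.
  replace (INR (S m)) with ((d + 1) / 2) by (rewrite S_INR, Hd; field).
  replace (INR m) with ((d - 1) / 2) by (rewrite Hd; field).
  rewrite RtoC_inv, !RtoC_div, RtoC_minus, RtoC_plus by (lra || exact Hd0).
  field. repeat split; try exact HdC; exact Hz.
Qed.

Lemma suffridge_middle_error_bound (rho : R) (m : nat) (z : C) :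
  rho < 1 -> Cmod z < rho ->
  Cmod (suffridge (2 * m + 1) (m + 1) z - koebe2 z)
  <= (2 * rho ^ 3 + 2 * rho ^ (2 * m + 1))
     / (INR (2 * m + 1) * (1 - rho ^ 2) ^ 2).
Proof.
  intros Hrho Hz.
  pose proof (Cmod_ge_0 z) as Hz0.
  assert (Hne : (1 + z ^ 2)%C <> 0) by (apply one_plus_sqr_neq0; lra).
  assert (HN : 0 < INR (2 * m + 1)) by (apply lt_0_INR; lia).
  assert (HNC : RtoC (INR (2 * m + 1)) <> 0)
    by (intros E; apply RtoC_inj in E; lra).
  rewrite (suffridge_middle_error m z Hne), Cmod_div
    by (apply Cmult_neq_0; [exact HNC | apply Cpow_nz, Hne]).
  rewrite !Cmod_mult, Cmod_pow, Cmod_R, Rabs_pos_eq by lra.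
  set (r := Cmod z) in *.
  assert (Hr2 : r ^ 2 <= rho ^ 2) by (apply pow_incr; lra).
  assert (Hden : 1 - rho ^ 2 <= Cmod (1 + z ^ 2)).
  { pose proof (Cmod_triangle (1 + z ^ 2) (- z ^ 2)) as T.
    replace (1 + z ^ 2 + - z ^ 2)%C with (RtoC 1) in T by ring.
    rewrite Cmod_opp, Cmod_pow, Cmod_1 in T. fold r in T. lra. }
  assert (Hrho2 : 0 < 1 - rho ^ 2) by nra.
  assert (Hnum : r * Cmod (2 * z ^ 2 + (- z ^ 2) ^ S m * (1 - z ^ 2))
                 <= 2 * rho ^ 3 + 2 * rho ^ (2 * m + 1)).
  { pose proof (Cmod_triangle (2 * z ^ 2) ((- z ^ 2) ^ S m * (1 - z ^ 2))) as T.
    pose proof (Cmod_triangle 1 (- z ^ 2)) as T1.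
    rewrite !Cmod_mult, !Cmod_pow, Cmod_opp, Cmod_pow, Cmod_R, Rabs_pos_eq in T
      by lra.
    rewrite Cmod_opp, Cmod_pow, Cmod_1 in T1.
    fold (Cminus 1 (z ^ 2)) in T1. fold r in T, T1.
    rewrite <- pow_mult in T.
    assert (P : 0 <= r ^ (2 * S m)) by (apply pow_le; lra).
    assert (P3 : r ^ 3 <= rho ^ 3) by (apply pow_incr; lra).
    assert (PN : r ^ (2 * m + 1) <= rho ^ (2 * m + 1)) by (apply pow_incr; lra).
    assert (PN0 : 0 <= r ^ (2 * m + 1)) by (apply pow_le; lra).
    assert (B : r ^ (2 * S m) * Cmod (1 - z ^ 2) <= r ^ (2 * S m) * 2)
      by (apply Rmult_le_compat_l; nra).
    (* The spare factor [r^2 <= 1] is given up so that the exponent becomes [N] itself. *)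
    assert (E : r * r ^ (2 * S m) = r ^ 2 * r ^ (2 * m + 1)).
    { replace (2 * S m)%nat with (S (2 * m + 1)) by lia. simpl. ring. }
    assert (r ^ 2 * r ^ (2 * m + 1) <= 1 * r ^ (2 * m + 1))
      by (apply Rmult_le_compat_r; nra).
    apply Rle_trans with (r * (2 * r ^ 2 + r ^ (2 * S m) * 2)).
    - apply Rmult_le_compat_l; lra.
    - replace (r * (2 * r ^ 2 + r ^ (2 * S m) * 2))
        with (2 * r ^ 3 + 2 * (r * r ^ (2 * S m))) by ring.
      lra. }
  apply Rmult_le_compat.
  - apply Rmult_le_pos; [lra | apply Cmod_ge_0].
  - apply Rlt_le, Rinv_0_lt_compat, Rmult_lt_0_compat; [lra |].
    apply pow_lt; lra.
  - exact Hnum.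
  - apply Rinv_le_contravar.
    + apply Rmult_lt_0_compat; [lra | apply pow_lt; lra].
    + apply Rmult_le_compat_l; [lra | apply pow_incr; lra].
Qed.

Lemma leading_constant_lt (rho : R) :
  0 < rho < 1 ->
  2 * rho ^ 3 / (1 - rho ^ 2) ^ 2 < 1 / (2 * (1 - rho) ^ 2).
Proof.
  intros Hrho.
  assert (H1 : 0 < 2 * (1 - rho) ^ 2)
    by (assert (0 < (1 - rho) ^ 2) by (apply pow_lt; lra); lra).
  assert (H2 : 0 < (1 - rho ^ 2) ^ 2) by (apply pow_lt; nra).
  (* [4 rho^3 < 4 rho^2 < (1 + rho)^2], since [2 rho < 1 + rho]. *)
  assert (H3 : 0 < (1 + rho) ^ 2 - 4 * rho ^ 3) by nra.
  apply Rlt_0_minus.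
  replace (1 / (2 * (1 - rho) ^ 2) - 2 * rho ^ 3 / (1 - rho ^ 2) ^ 2)
    with (((1 + rho) ^ 2 - 4 * rho ^ 3) / (2 * (1 - rho ^ 2) ^ 2))
    by (field; split; nra).
  apply Rdiv_lt_0_compat; lra.
Qed.

Theorem mainTheorem5 :
  forall rho : R, 0 < rho < 1 ->
  exists eps : nat -> R,
    is_lim_seq (fun N : nat => INR N * eps N) (Finite 0) /\
    eventually (fun N : nat => Nat.Odd N ->
      Rbar_lt
        (sup_disc rho (fun z : C => (suffridge N ((N + 1) / 2) z - koebe2 z)%C))
        (Finite (1 / (2 * (1 - rho) ^ 2 * INR N) + eps N))).
Proof.
  intros rho Hrho.
  assert (H2 : 0 < (1 - rho ^ 2) ^ 2) by (apply pow_lt; nra).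
  (* This is the geometrically small part of the error bound; [N * eps N] is a multiple of [rho^N]
     once [N >= 1]. *)
  exists (fun N => 2 * rho ^ N / (1 - rho ^ 2) ^ 2 / INR N).
  split.
  - apply is_lim_seq_ext_loc with (fun N => 2 / (1 - rho ^ 2) ^ 2 * rho ^ N).
    + exists 1%nat. intros N HN.
      assert (0 < INR N) by (apply lt_0_INR; lia).
      field. split; [nra | lra].
    + replace (Finite 0) with (Rbar_mult (2 / (1 - rho ^ 2) ^ 2) 0)
        by (simpl; f_equal; ring).
      apply is_lim_seq_scal_l, is_lim_seq_geom.
      rewrite Rabs_pos_eq; lra.
  - exists 0%nat. intros N _ [m ->].
    replace ((2 * m + 1 + 1) / 2)%nat with (m + 1)%nat
      by (replace (2 * m + 1 + 1)%nat with ((m + 1) * 2)%nat by lia;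
          now rewrite Nat.div_mul).
    assert (HN : 0 < INR (2 * m + 1)) by (apply lt_0_INR; lia).
    (* A supremum inherits only a non-strict bound; strictness comes from [leading_constant_lt],
       after [eps N] cancels on both sides. This works for every odd [N], hence the threshold 0. *)
    apply Rbar_le_lt_trans with
      (Finite ((2 * rho ^ 3 + 2 * rho ^ (2 * m + 1))
               / (INR (2 * m + 1) * (1 - rho ^ 2) ^ 2))).
    + apply Lub_Rbar_correct. intros x [z [Hz ->]].
      apply suffridge_middle_error_bound; lra.
    + pose proof (leading_constant_lt rho Hrho) as HL.
      unfold Rbar_lt.
      set (N := INR (2 * m + 1)) in *. set (p := rho ^ (2 * m + 1)).
      replace ((2 * rho ^ 3 + 2 * p) / (N * (1 - rho ^ 2) ^ 2))
        with (2 * rho ^ 3 / (1 - rho ^ 2) ^ 2 / N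
              + 2 * p / (1 - rho ^ 2) ^ 2 / N)
        by (field; split; nra).
      replace (1 / (2 * (1 - rho) ^ 2 * N))
        with (1 / (2 * (1 - rho) ^ 2) / N) by (field; split; nra).
      apply Rplus_lt_compat_r, Rmult_lt_compat_r; [| exact HL].
      apply Rinv_0_lt_compat, HN.
Qed.
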